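(* Let $T$ be an $N\times N$ nonnegative irreducible matrix and let $\alpha>0$. Let $C$ be the $N\times N$ $0$–$1$ matrix with $C_{ij}=1$ if $T_{ji}>0$ and $C_{ij}=0$ otherwise. Then there exists a positive vector $\mathbf t\in\mathbb R^N$ such that $$\mathbf t^{\,1+\alpha}=D(\mathbf t)\,T^{\mathsf T}\,\mathbf t,$$ where $D(\mathbf t)$ is the diagonal matrix whose $i$-th diagonal entry is $$d_i=\frac{\big(\mathbf e_i C\,\mathrm{diag}(\mathbf t)\,\mathbf t\big)^{\alpha}}{\big(\mathbf e_i C\mathbf t\big)^{1+\alpha}},$$ and the power of a vector is taken entrywise. Equivalently, for each $i$, writing $S_i=\{j: T_{ji}>0\}$, $$t_i=\left[\left(\frac{\sum_{j\in S_i}T_{ji}t_j}{\sum_{j\in S_i}t_j}\right)\left(\frac{\sum_{j\in S_i}t_j^2}{\sum_{j\in S_i}t_j}\right)^{\alpha}\right]^{\frac{1}{1+\alpha}}.$$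
   Context: $T^{\mathsf T}$ is the transpose of $T$. $\mathbf e_i$ denotes the row vector whose $i$-th entry is $1$ and all others $0$; $\mathrm{diag}(\mathbf t)$ is the diagonal matrix with $ii$-th entry $t_i$. A vector or matrix is nonnegative/positive if all entries are real and nonnegative/positive. In the application, $T_{ij}$ is the local trust that peer $i$ assigns to peer $j$ (zero if no interaction), $\mathbf t$ is the global trust vector, and $\alpha=q/p$ for positive constants $p,q$. *)

(* Defs.v *)
From Stdlib Require Import Reals.
Open Scope R_scope.

(* Vectors in R^N: functions nat -> R, meaningful on indices < N.
   Matrices in R^{N x N}: functions nat -> nat -> R, entry (i,j) = M i j. *)

Fixpoint msum (n : nat) (f : nat -> R) : R :=
  match n with
  | O => 0
  | S n' => msum n' f + f n'
  end.

Definition trmx (M : nat -> nat -> R) : nat -> nat -> R := fun i j => M j i.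

Definition mulmv (N : nat) (M : nat -> nat -> R) (v : nat -> R) : nat -> R :=
  fun i => msum N (fun j => M i j * v j).

Definition mulmx (N : nat) (A B : nat -> nat -> R) : nat -> nat -> R :=
  fun i j => msum N (fun l => A i l * B l j).

Fixpoint mpow (N : nat) (M : nat -> nat -> R) (k : nat) : nat -> nat -> R :=
  match k with
  | O => fun i j => if Nat.eqb i j then 1 else 0
  | S k' => mulmx N (mpow N M k') M
  end.

Definition nonneg_mx (N : nat) (M : nat -> nat -> R) : Prop :=
  forall i j, (i < N)%nat -> (j < N)%nat -> 0 <= M i j.

Definition irreducible (N : nat) (M : nat -> nat -> R) : Prop :=
  forall i j, (i < N)%nat -> (j < N)%nat ->
    exists k : nat, (1 <= k)%nat /\ 0 < mpow N M k i j.

Definition Cmx (T : nat -> nat -> R) : nat -> nat -> R :=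
  fun i j => if Rlt_dec 0 (T j i) then 1 else 0.

Definition Dentry (N : nat) (T : nat -> nat -> R) (alpha : R) (t : nat -> R)
    (i : nat) : R :=
  Rpower (mulmv N (Cmx T) (fun j => t j * t j) i) alpha
  / Rpower (mulmv N (Cmx T) t i) (1 + alpha).

(* Main.v *)
(* Writing w_i for the mean of t over S_i with weights t_j and v_i for the mean of
   T_{ji} with the same weights, the equation is t_i^(1+alpha) = w_i^alpha v_i, whose
   right-hand side is homogeneous of degree alpha.  It therefore suffices to find a
   positive solution of F(t) = lambda t for F_i = (w_i^alpha v_i)^(1/(1+alpha)), and
   then to rescale.  Such an eigenvector comes from a Brouwer-type statement on a
   simplex: if at every point x some g_i(x) >= 0, then at some point every i has
   x_i = 0 or g_i(x) >= 0.  This is the limit, by Bolzano-Weierstrass, of Scarf's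
   combinatorial lemma applied to grid points ordered by each coordinate.
   Irreducibility is only needed to make every S_i nonempty. *)
Require Import Defs.
From Stdlib Require Import Reals Lra Lia IndefiniteDescription.
From Coquelicot Require Import Coquelicot.
Open Scope R_scope.

(** * Scarf's lemma *)

Module Scarf.
From mathcomp Require Import all_boot zify.
Set Implicit Arguments.
Unset Strict Implicit.
Unset Printing Implicit Defensive.
Local Open Scope nat_scope.

(** * Dominant sets in a finite family of orders *)

Section Scarf.
Variables (I Z : finType) (r : I -> Z -> nat).
Hypothesis r_inj : forall i, injective (r i).

(** Scarf's dominance: no [z] lies strictly above the minimum of [S] in every order at once. *)
Definition dominant (S : {set Z}) : bool :=
  [forall z, exists i, forall x in S, r i z <= r i x].

Lemma dominantP (S : {set Z}) :
  reflect (forall z, exists i, forall x, x \in S -> r i z <= r i x) (dominant S).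
Proof.
apply: (iffP forallP) => H z; have := H z.
  by case/existsP=> i /forall_inP Hi; exists i.
by case=> i Hi; apply/existsP; exists i; apply/forall_inP.
Qed.

Lemma dominantS (S S' : {set Z}) : S' \subset S -> dominant S -> dominant S'.
Proof.
move=> /subsetP sS /dominantP dS; apply/dominantP=> z; have [i Hi] := dS z.
by exists i => x /sS /Hi.
Qed.

Definition minfun (S : {set Z}) (m : I -> Z) : Prop :=
  forall i, m i \in S /\ (forall x, x \in S -> r i (m i) <= r i x).

Lemma minfun_exists (S : {set Z}) (x0 : Z) :
  x0 \in S -> exists m, minfun S m.
Proof.
move=> Sx0; exists (fun i => [arg min_(x < x0 in S) r i x]) => i.
by case: arg_minnP => // x Sx Hx; split.
Qed.

Lemma minfun_uniq (S : {set Z}) (m : I -> Z) (i : I) (x : Z) :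
  minfun S m -> x \in S -> (forall y, y \in S -> r i x <= r i y) -> m i = x.
Proof.
move=> Hm Sx Hx; have [Smi Hmi] := Hm i.
by apply: (@r_inj i); apply/eqP; rewrite eqn_leq Hmi //= Hx.
Qed.

(** Dominance applied to [x] itself yields an order in which [x] is the minimum of [S]. *)
Lemma dominant_minfun_surj (S : {set Z}) (m : I -> Z) (x : Z) :
  dominant S -> minfun S m -> x \in S -> exists i, m i = x.
Proof.
move=> /dominantP dS Hm Sx; have [i Hi] := dS x.
by exists i; apply: minfun_uniq.
Qed.

(** * Adding one element to a dominant set *)

Section Pivot.
Variables (S : {set Z}) (m : I -> Z) (i j : I).
Hypotheses (dS : dominant S) (Hm : minfun S m) (cardS : #|I| = #|S|.+1).
Hypotheses (neq_ij : i != j) (eq_m : m i = m j).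

(** Since [m] maps onto [S], dropping one of two colliding indices loses no value. The sizes then
    agree, so [m] is injective off [k], and the colliding pair is unique. *)
Let im_setC1 (k k' : I) : k != k' -> m k = m k' -> m @: [set~ k] = S.
Proof.
move=> nkk' ekk'; apply/setP=> x; apply/imsetP/idP => [[l _ ->]|Sx].
  by have [] := Hm l.
have [l <-] := dominant_minfun_surj dS Hm Sx.
have [->|nlk] := eqVneq l k; first by exists k'; rewrite // !inE eq_sym.
by exists l; rewrite // !inE.
Qed.

Let inj_setC1 (k k' : I) : k != k' -> m k = m k' -> {in [set~ k] &, injective m}.
Proof.
move=> nkk' ekk'; apply/imset_injP; rewrite (im_setC1 nkk' ekk').
by rewrite cardsC1 cardS.
Qed.

Let pairP (k l : I) : k != l -> m k = m l -> (k == i) || (k == j).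
Proof.
move=> nkl ekl; apply: contraT; rewrite negb_or => /andP[nki nkj].
have [eli|nli] := eqVneq l i.
  have ekj : k = j.
    apply: (inj_setC1 neq_ij eq_m); rewrite ?inE //; last by rewrite ekl eli.
    by rewrite eq_sym.
  by rewrite ekj eqxx in nkj.
have := inj_setC1 neq_ij eq_m; move/(_ k l); rewrite !inE => /(_ nki nli ekl) e.
by rewrite e eqxx in nkl.
Qed.

(* Adding y to S creates the new minimum of order k while each [m l], l != k,
   stays the minimum of order l; among these candidates exactly the best one
   for order k keeps the set dominant. *)
Definition pivots (k : I) : {set Z} :=
  [set y | [forall l, (l != k) ==> (r l (m l) < r l y)]].

Definition best_pivots (k : I) : {set Z} :=
  [set y in pivots k | [forall z in pivots k, r k z <= r k y]].

Let pivotsP (k : I) (y : Z) :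
  reflect (forall l, l != k -> r l (m l) < r l y) (y \in pivots k).
Proof.
by rewrite inE; apply: (iffP forallP) => H l; [move/implyP: (H l)|apply/implyP/H].
Qed.


Let card_best_pivots (k : I) : #|best_pivots k| = (pivots k != set0).
Proof.
have [e|[y0 Py0]] := set_0Vmem (pivots k).
  rewrite e eqxx; apply/eqP; rewrite cards_eq0 -subset0 -e.
  by apply/subsetP=> y; rewrite /best_pivots inE => /andP[].
have -> : pivots k != set0 by apply/set0Pn; exists y0.
apply/eqP/cards1P; case: (arg_maxnP (r k) Py0) => y Py Hy.
exists y; apply/setP=> z; rewrite in_set1 /best_pivots inE.
apply/andP/eqP => [[Pz /forall_inP Hz]|->].
  have le_zy : r k z <= r k y := Hy z Pz.
  by apply: (@r_inj k); apply/eqP; rewrite eqn_leq le_zy Hz.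
by split=> //; apply/forall_inP=> z' Pz'; apply: Hy.
Qed.

(** A member of [S] equals [m l] for some [l], and the collision allows [l] to be taken different
    from [k]; the strict inequality in order [l] then fails. *)
Let pivots_notin (k k' : I) (y : Z) :
  k != k' -> m k = m k' -> y \in pivots k -> y \notin S.
Proof.
move=> nkk' ekk' /pivotsP Hy; apply/negP => Sy.
have [l el] := dominant_minfun_surj dS Hm Sy; move: Hy; rewrite -el => Hy.
have [elk|nlk] := eqVneq l k; last by have := Hy l nlk; rewrite ltnn.
by have := Hy k'; rewrite elk ekk' ltnn eq_sym => /(_ nkk').
Qed.

(** If [z] is a pivot, order [k] serves: dominance of [S] at [z] can use no other order, and [y] is
    the best pivot. Otherwise [z] is at most [m l] in some order [l] other than [k], where [y]
    exceeds [m l]. *)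
Let dominant_add_best (k : I) (y : Z) : y \in best_pivots k -> dominant (y |: S).
Proof.
rewrite /best_pivots inE => /andP[/pivotsP Hy /forall_inP Hmax].
apply/dominantP=> z; have [Pz|/pivotsP nPz] := boolP (z \in pivots k).
  exists k => x; rewrite in_setU1 => /predU1P[->|Sx]; first exact: Hmax.
  move/dominantP: dS => /(_ z)[l Hl].
  have [<-|nlk] := eqVneq l k; first exact: Hl.
  move/pivotsP: Pz => /(_ l nlk); rewrite ltnNge Hl //.
  by have [] := Hm l.
have [l nlk Hl] : exists2 l, l != k & r l z <= r l (m l).
  apply/exists_inP; apply: contraT; rewrite negb_exists_in => /forall_inP H.
  by case: nPz => l nlk; rewrite ltnNge H.
exists l => x; rewrite in_setU1 => /predU1P[->|Sx].
  exact: leq_trans Hl (ltnW (Hy l nlk)).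
by apply: leq_trans Hl _; have [_] := Hm l; apply.
Qed.

(** Let [k] be an order in which [y] becomes the minimum. Every member of [S] must stay the minimum
    in some order, so the orders [A] with [m l] below [y] still map onto [S]. By counting, [A] is
    everything but [k]; hence [k] belongs to the colliding pair, and [y] is a pivot for it. *)
Let dominant_add_is_best (y : Z) : y \notin S -> dominant (y |: S) ->
  exists2 k, (k == i) || (k == j) & y \in best_pivots k.
Proof.
move=> nSy dyS.
have [k Hk] := (dominantP _ dyS) y.
have Hlow x : x \in S -> exists l, m l = x /\ r l (m l) < r l y.
  move=> Sx; have [l Hl] := (dominantP _ dyS) x.
  have lx : m l = x.
    by apply: minfun_uniq => // z Sz; apply: Hl; rewrite in_setU1 Sz orbT.
  exists l; split => //; rewrite lx ltn_neqAle Hl ?setU11 // andbT.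
  by apply: contraNneq nSy => /r_inj <-.
pose A := [set l | r l (m l) < r l y].
have mA : m @: A = S.
  apply/setP=> x; apply/imsetP/idP => [[l _ ->]|/Hlow[l [el Hl]]].
    by have [] := Hm l.
  by exists l => //; rewrite inE.
have nAk : k \notin A.
  by rewrite inE -leqNgt Hk // in_setU1; have [-> _] := Hm k; rewrite orbT.
have AE : A = [set~ k].
  apply/eqP; rewrite eqEcard; apply/andP; split.
    by apply/subsetP=> l Al; rewrite !inE; apply: contraTneq Al => ->.
  by rewrite cardsC1 cardS /= -mA leq_imset_card.
exists k.
  have : m k \in m @: [set~ k] by rewrite -AE mA; have [] := Hm k.
  by case/imsetP=> l; rewrite !inE => nlk; apply: pairP; rewrite eq_sym.
have Py : y \in pivots k.
  by apply/pivotsP=> l nlk; suff : l \in A; [rewrite inE|rewrite AE !inE].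
rewrite /best_pivots inE Py /=; apply/forall_inP=> z /pivotsP Pz.
have [l Hl] := (dominantP _ dyS) z.
have [elk|nlk] := eqVneq l k; first by rewrite -elk Hl ?setU11.
have := Pz l nlk; rewrite ltnNge Hl // in_setU1.
by have [-> _] := Hm l; rewrite orbT.
Qed.

Lemma card_pivot :
  #|[set y | (y \notin S) && dominant (y |: S)]|
    = (pivots i != set0) + (pivots j != set0).
Proof.
rewrite -!card_best_pivots -cardsUI.
(* A common element would exceed [m l] in every order [l], against the dominance of [S]. *)
have -> : best_pivots i :&: best_pivots j = set0.
  apply/eqP; rewrite -subset0; apply/subsetP=> y.
  case/setIP=> /setIdP[/pivotsP Pi _] /setIdP[/pivotsP Pj _].
  have [l Hl] := (dominantP _ dS) y; have [Sml _] := Hm l.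
  have [eli|nli] := eqVneq l i.
    by have := Pj l; rewrite ltnNge Hl // eli neq_ij => /(_ isT).
  by have := Pi l nli; rewrite ltnNge Hl.
rewrite cards0 addn0; apply: eq_card => y; rewrite inE in_setU.
apply/andP/orP => [[nSy dy]|[]b].
- by have [k /orP[]/eqP-> ?] := dominant_add_is_best nSy dy; [left|right].
- split; last exact: dominant_add_best b.
  by apply: (pivots_notin neq_ij eq_m); case/setIdP: b.
split; last exact: dominant_add_best b.
apply: (@pivots_notin j i) => //; first by rewrite eq_sym.
by case/setIdP: b.
Qed.

End Pivot.

Lemma minfun_collision (S : {set Z}) (m : I -> Z) :
  minfun S m -> #|I| = #|S|.+1 -> exists i j, i != j /\ m i = m j.
Proof.
move=> Hm cardS.
have : ~~ injectiveb m.
  apply/negP=> /injectiveP/card_imset H.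
  suff: #|[set: I]| <= #|S| by rewrite cardsT cardS ltnn.
  rewrite -(H (mem [set: I])); apply/subset_leq_card/subsetP=> x /imsetP[i _ ->].
  by have [] := Hm i.
by case/injectivePn => i [j nij eij]; exists i, j.
Qed.

(* The slack element [s k] is below everything in order k and above all
   non-slack elements in the other orders: it encodes the absence of the
   index k, so that all dominant sets of interest have exactly #|I| elements. *)
Variables (s : I -> Z) (c : Z -> I).
Hypothesis s_least : forall k z, r k (s k) <= r k z.
Hypothesis s_large :
  forall k l z, (forall p, z != s p) -> l != k -> r l z < r l (s k).
Hypothesis c_s : forall k, c (s k) = k.
Hypothesis card_I : 1 < #|I|.
Variable z0 : Z.
Hypothesis z0_s : forall p, z0 != s p.

(** * The parity argument with slack elements *)

Definition slack (z : Z) : bool := [exists p, z == s p].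

Lemma slackPn (z : Z) : reflect (forall p, z != s p) (~~ slack z).
Proof. by rewrite negb_exists; apply: forallP. Qed.

(** In orders other than [k], the minimum of [S] is at most the non-slack [x], which is below [s k].
    So [s k] is a pivot for [k], and both colliding orders contribute one extension. *)
Lemma card_pivot_interior (S : {set Z}) (x : Z) :
  dominant S -> #|I| = #|S|.+1 -> x \in S -> ~~ slack x ->
  #|[set y | (y \notin S) && dominant (y |: S)]| = 2.
Proof.
move=> dS cS Sx /slackPn nx; have [m Hm] := minfun_exists Sx.
have [i [j [nij eij]]] := minfun_collision Hm cS.
rewrite (card_pivot dS Hm cS nij eij).
suff H k : pivots m k != set0 by rewrite !H.
apply/set0Pn; exists (s k); rewrite inE; apply/forallP=> l; apply/implyP=> nlk.
by apply: leq_ltn_trans (s_large nx nlk); have [_] := Hm l; apply.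
Qed.

(** The minimum in each order [l] other than [i0] is [s l], so [i0] collides with some [p]. The
    non-slack [z0] is a pivot for [i0]. A pivot for [p] would have to exceed [s p] in order [i0],
    hence be some slack [s q] with [q] different from [p]; but [s q] is least in order [q]. *)
Lemma card_pivot_boundary (i0 : I) :
  let S := [set s k | k in [set~ i0]] in
  dominant S -> #|[set y | (y \notin S) && dominant (y |: S)]| = 1.
Proof.
move=> S dS.
have cS : #|I| = #|S|.+1.
  by rewrite card_imset ?cardsC1 ?prednK ?(ltnW card_I) //; apply: can_inj c_s.
have [x0 Sx0] : exists x, x \in S by apply/card_gt0P; rewrite -ltnS -cS.
have [m Hm] := minfun_exists Sx0.
have ms l : l != i0 -> m l = s l.
  move=> nl; apply: minfun_uniq Hm _ _ => //.
  by apply: imset_f; rewrite !inE.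
have [p np ep] : exists2 p, p != i0 & m i0 = s p.
  by have [/imsetP[p]] := Hm i0; rewrite !inE => np ep _; exists p.
have nip : i0 != p by rewrite eq_sym.
rewrite (card_pivot dS Hm cS nip) ?ep ?ms //.
have -> : pivots m i0 != set0.
  apply/set0Pn; exists z0; rewrite inE; apply/forallP=> l; apply/implyP=> nl.
  rewrite ms // ltn_neqAle s_least andbT.
  by apply: contraNneq (z0_s l) => /r_inj ->.
suff -> : pivots m p = set0 by rewrite eqxx.
apply/eqP; rewrite -subset0; apply/subsetP=> y; rewrite inE => /forallP Py.
have /implyP/(_ nip) := Py i0; rewrite ep => lt_py.
have [/existsP[q /eqP eq]|/slackPn ny] := boolP (slack y); last first.
  by have := s_large ny nip; rewrite ltnNge ltnW.
have [eqp|nqp] := eqVneq q p; first by rewrite eq eqp ltnn in lt_py.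
have /implyP/(_ nqp) := Py q.
by rewrite eq ltnNge s_least.
Qed.

(** The count is 0 or 2. If deleting [y] leaves each colour but [i0] exactly once, then [y] repeats
    the colour of a unique [y'], since [R] is not fully coloured, and only [y] and [y'] can be
    deleted. *)
Lemma doors_even (i0 : I) (R : {set Z}) : #|R| = #|I| -> c @: R != setT ->
  ~~ odd #|[set y in R | c @: (R :\ y) == [set~ i0]]|.
Proof.
move=> cR ncR; set E := [set y in R | _].
have [->|[y]] := set_0Vmem E; first by rewrite cards0.
rewrite inE => /andP[Ry /eqP cRy].
have injc : {in R :\ y &, injective c}.
  by apply/imset_injP; rewrite cRy cardsC1 -cR (cardsD1 y) Ry.
have RE : R = y |: (R :\ y) by rewrite setD1K.
have ncy : c y != i0.
  apply: contraNneq ncR => cy; rewrite RE imsetU1 cRy cy.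
  by apply/eqP/setP=> k; rewrite !inE orbN.
have : c y \in c @: (R :\ y) by rewrite cRy !inE.
case/imsetP=> y'; rewrite !inE => /andP[ny' Ry'] ecy.
suff -> : E = [set y; y'] by rewrite cards2 eq_sym ny'.
apply/setP=> z; rewrite in_set2 inE; apply/andP/orP => [[Rz /eqP cRz]|].
  have [ezy|nzy] := eqVneq z y; [by left|right].
  have : c z \in c @: (R :\ z).
    by rewrite cRz -cRy; apply: imset_f; rewrite !inE nzy.
  case/imsetP=> w; rewrite !inE => /andP[nwz Rw] ecz.
  have [ewy|nwy] := eqVneq w y.
    by apply/eqP; apply: injc; rewrite ?inE ?nzy ?ny' // ecz ewy.
  by case/negP: nwz; apply/eqP; apply: injc; rewrite ?inE ?nzy ?nwy.
case=> /eqP->; first by rewrite Ry cRy.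
split=> //; rewrite -cRy; apply/eqP/setP=> k.
apply/imsetP/imsetP => -[w]; rewrite !inE => /andP[nw Rw] ->.
  have [->|nwy] := eqVneq w y; first by exists y'; rewrite ?inE ?ny'.
  by exists w; rewrite ?inE ?nwy.
have [->|nwy'] := eqVneq w y'; first by exists y; rewrite ?inE ?Ry ?andbT // eq_sym.
by exists w; rewrite ?inE ?nwy'.
Qed.


(* Parity: count the pairs (S, y) where S has #|I|.-1 elements and all colors
   but i0, and y |: S is dominant.  By S, only the all-slack S contributes an
   odd number; by R := y |: S, every R which is not fully colored contributes
   an even number. *)
Lemma scarf_slack : exists S, dominant S /\ c @: S = setT.
Proof.
have /card_gt0P[i0 _] : 0 < #|I| by apply: ltnW.
suff /existsP[S /andP[dS /eqP cS]] : [exists S, dominant S && (c @: S == setT)].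
  by exists S.
apply: contraT; rewrite negb_exists => /forallP none.
pose door (S : {set Z}) y := [&& c @: S == [set~ i0], #|S| == #|I|.-1, y \notin S
   & dominant (y |: S)].
have sum_swap : \sum_(S : {set Z}) \sum_(y | door S y) 1 =
   \sum_(R : {set Z}) \sum_(y | (y \in R) && door (R :\ y) y) 1.
  rewrite (exchange_big_dep xpredT) //= [RHS](exchange_big_dep xpredT) //=.
  apply: eq_bigr => y _.
  (* For fixed [y], adding and deleting [y] are inverse bijections between the two index sets. *)
  rewrite (reindex_onto (fun R => R :\ y) (fun S => y |: S)) /=.
    apply: eq_bigl => R; rewrite andbC; congr (_ && _).
    apply/eqP/idP => [<-|]; [exact: setU11|exact: setD1K].
  by move=> S /and4P[_ _ nSy _]; rewrite setU1K.
have : odd (\sum_(S : {set Z}) \sum_(y | door S y) 1) = false.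
  rewrite sum_swap; apply/negbTE.
  elim/big_ind: _ => // [a b|R _].
    by rewrite oddD => /negbTE-> /negbTE->.
  rewrite sum1_card.
  have [/andP[dR /eqP cR]|ndR] := boolP (dominant R && (#|R| == #|I|)).
    have -> : #|[pred y | (y \in R) && door (R :\ y) y]| =
              #|[set y in R | c @: (R :\ y) == [set~ i0]]|.
      apply: eq_card => y; rewrite !inE; apply: andb_id2l => Ry.
      rewrite /door setD1K // dR setD11 /= andbT.
      by rewrite -cR (cardsD1 y R) Ry eqxx andbT.
    by apply: doors_even => //; have := none R; rewrite dR.
  rewrite eq_card0 // => y; rewrite !inE; apply: contraNF ndR.
  case/andP=> Ry /and4P[_ /eqP cR _]; rewrite setD1K // => ->.
  by rewrite (cardsD1 y R) Ry cR add1n prednK ?eqxx // ltnW.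
pose S0 := [set s k | k in [set~ i0]].
have cS0 : #|S0| = #|I|.-1.
  by rewrite card_imset ?cardsC1 //; apply: can_inj c_s.
have dS0 : dominant S0.
  apply/dominantP=> z.
  have [/existsP[q /eqP->]|/slackPn nz] := boolP (slack z).
    by exists q => x _; apply: s_least.
  exists i0 => x /imsetP[k]; rewrite !inE => nk ->.
  by apply/ltnW/s_large => //; rewrite eq_sym.
have ccS0 : c @: S0 = [set~ i0].
  rewrite -imset_comp -[RHS]imset_id; apply: eq_imset => k.
  exact: c_s.
rewrite (bigD1 S0) //= sum1_card oddD.
have -> : #|door S0| = 1.
  rewrite -(card_pivot_boundary dS0); apply: eq_card => y; rewrite !inE.
  by rewrite unfold_in /door ccS0 cS0 !eqxx.
suff /negbTE-> : ~~ odd (\sum_(S | S != S0) \sum_(y | door S y) 1) by [].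
elim/big_ind: _ => // [a b|S nS]; first by rewrite oddD => /negbTE-> /negbTE->.
rewrite sum1_card.
have [/and3P[dS /eqP cS /eqP kS]|ndS] :=
  boolP [&& dominant S, #|S| == #|I|.-1 & c @: S == [set~ i0]]; last first.
  rewrite eq_card0 // => y; rewrite unfold_in; apply: contraNF ndS.
  case/and4P=> -> -> _ dyS; rewrite !andbT; apply: dominantS dyS; exact: subsetUr.
(* A set of slack elements with all colours but [i0] is contained in [S0], hence equal to it by
   cardinality. *)
have [x Sx nx] : exists2 x, x \in S & ~~ slack x.
  apply/exists_inP; apply: contraR nS; rewrite negb_exists_in => /forall_inP H.
  rewrite eqEcard cS cS0 leqnn andbT; apply/subsetP=> x Sx.
  have /existsP[p /eqP ex] : slack x by have := H x Sx; rewrite negbK.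
  by rewrite ex; apply: imset_f; rewrite -kS -[p]c_s -ex; apply: imset_f.
suff -> : #|door S| = 2 by [].
rewrite -(card_pivot_interior dS _ Sx nx); last by rewrite cS prednK // ltnW.
by apply: eq_card => y; rewrite unfold_in !inE /door kS cS !eqxx.
Qed.

End Scarf.

Lemma scarf (I X : finType) (r : I -> X -> nat) (c : X -> I) :
  1 < #|I| -> 0 < #|X| ->
  exists S : {set X},
    forall y, exists2 i, i \in c @: S & forall x, x \in S -> r i y <= r i x.
Proof.
move=> cI /card_gt0P[x0 _].
pose K := #|X|; have K0 : 0 < K by apply/card_gt0P; exists x0.
(* r1 breaks ties in r; r2 adjoins the slack elements. *)
pose r1 i x := r i x * K + enum_rank x.
have r1_le i x y : r1 i x <= r1 i y -> r i x <= r i y.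
  move=> /(leq_div2r K); rewrite /r1 !divnMDl // !divn_small ?ltn_ord //.
  by rewrite !addn0.
have r1_inj i : injective (r1 i).
  move=> x y /(congr1 (modn^~ K)); rewrite /r1 !modnMDl !modn_small ?ltn_ord //.
  by move/val_inj/enum_rank_inj.
pose B := \sum_i \sum_x (r1 i x).
have leB i x : r1 i x <= B.
  by rewrite /B (bigD1 i) //= (bigD1 x) //= -addnA leq_addr.
pose r2 i (z : X + I) := match z with
  | inl x => (r1 i x).+1
  | inr k => if k == i then 0 else (B + enum_rank k).+2
  end.
have r2_inj i : injective (r2 i).
  move=> [x|k] [y|l] /=.
  - by move=> [] /r1_inj ->.
  - by case: eqP => // _ [] e; have := leB i x; rewrite e ltnNge leq_addr.
  - by case: eqP => // _ [] e; have := leB i y; rewrite -e ltnNge leq_addr.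
  case: eqP => [->|_]; case: eqP => [->|_] // [] /addnI /val_inj /enum_rank_inj.
  by move->.
have [] := @scarf_slack I (X + I)%type r2 r2_inj inr
  (fun z => match z with inl x => c x | inr k => k end) _ _ _ cI (inl x0).
- by move=> k z; rewrite /= eqxx.
- move=> k l [x|p] H nlk; last by have := H p; rewrite eqxx.
  by rewrite /= eq_sym (negbTE nlk) !ltnS (leq_trans (leB l x)) ?leq_addr.
- by [].
- by [].
move=> S [/dominantP dS cS]; exists [set x | inl x \in S] => y.
have [i Hi] := dS (inl y); exists i; last first.
  by move=> x; rewrite inE => /Hi; rewrite ltnS => /r1_le.
(* If the element of [S] with colour [i] were slack, it would be [inr i], whose value 0 in order [i]
   is below the value of [y]. *)
have : i \in setT by rewrite inE.
rewrite -cS => /imsetP[[x|k] Sz ei]; first by apply/imsetP; exists x; rewrite ?inE.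
by have := Hi _ Sz; rewrite /= ei eqxx.
Qed.

(** Scarf's lemma is applied with coordinates as orders and, as colour of [x], an index [i] with
    [P i x]. Let [J] be the set of colours that occur in [S] and [mu] the coordinatewise minimum
    over [S]. The sum of [mu] over [J] exceeds M - n, so little mass remains: on [S], coordinates
    off [J] are at most n, and those in [J] are within n of [mu]. *)
Lemma simplex_grid (n M : nat) (P : nat -> (nat -> nat) -> Prop) :
  1 < n ->
  (forall x : nat -> nat, \sum_(i < n) x i = M -> exists2 i, i < n & P i x) ->
  exists (x : nat -> nat) (y : nat -> nat -> nat),
    \sum_(i < n) x i = M /\
    forall i, i < n ->
      [/\ \sum_(j < n) y i j = M,
          forall j, j < n -> x j <= y i j + n /\ y i j <= x j + n
        & x i <= n \/ P i (y i)].
Proof.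
move=> n1 HP.
pose X := {x : {ffun 'I_n -> 'I_M.+1} | \sum_i x i == M}.
pose ext (x : X) k := if insub k is Some i then nat_of_ord (val x i) else 0.
have extE x (i : 'I_n) : ext x i = val x i by rewrite /ext valK.
have sum_ext x : \sum_(i < n) ext x i = M.
  by rewrite -[RHS](eqP (valP x)); apply: eq_bigr => i _; rewrite extE.
have mk (f : 'I_n -> nat) :
    \sum_i f i = M -> exists x : X, forall i : 'I_n, ext x i = f i.
  move=> sf; have f_lt i : f i < M.+1 by rewrite ltnS -sf (bigD1 i) //= leq_addr.
  pose x0 := [ffun i => Ordinal (f_lt i)].
  have sx0 : \sum_i x0 i == M.
    by rewrite -[X in _ == X]sf; apply/eqP/eq_bigr=> i _; rewrite ffunE.
  by exists (exist _ x0 sx0) => i; rewrite extE /= ffunE.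
have [c cP] : exists c : X -> 'I_n, forall x, P (c x) (ext x).
  apply: (@fin_all_exists _ (fun=> 'I_n) (fun x i => P i (ext x))) => x.
  by have [i lt_in Pi] := HP _ (sum_ext x); exists (Ordinal lt_in).
have i0 : 'I_n := Ordinal (ltnW n1).
have [xM _] : exists x : X, forall i : 'I_n, ext x i = if i == i0 then M else 0.
  by apply: mk; rewrite -big_mkcond big_pred1_eq.
have [] := @scarf 'I_n X (fun i x => ext x i) c; rewrite ?card_ord //.
  by apply/card_gt0P; exists xM.
move=> S HS; set J := c @: S in HS.
have [i1 Ji1 _] := HS xM; have /imsetP[x0 Sx0 _] := Ji1.
have [mu Hmu] : exists mu : 'I_n -> nat, forall i : 'I_n,
    (exists2 x, x \in S & ext x i = mu i) /\ (forall x, x \in S -> mu i <= ext x i).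
  exists (fun i : 'I_n => ext [arg min_(x < x0 in S) ext x i] i) => i.
  by case: arg_minnP => // x Sx Hx; split=> //; exists x.
have ltM : M < \sum_(i in J) mu i + n.
  have : M < \sum_(i in J) (mu i).+1.
    rewrite ltnNge; apply/negP=> leM.
    (* The coordinate [i1] absorbs the surplus, so that [f] sums to M. This grid point exceeds [mu]
       throughout [J], which Scarf's lemma forbids. *)
    pose f (i : 'I_n) := if i \in J then
      (mu i).+1 + (if i == i1 then M - \sum_(i in J) (mu i).+1 else 0) else 0.
    have [y Hy] : exists y : X, forall i : 'I_n, ext y i = f i.
      apply: mk; rewrite -big_mkcond big_split /= -big_mkcondr.
      rewrite [X in _ + X](big_pred1 i1) ?subnKC // => i /=.
      by case: eqP => [->|]; rewrite ?Ji1 ?andbF.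
    have [i Ji Hi] := HS y; have [[x Sx ex] _] := Hmu i.
    by have := Hi x Sx; rewrite Hy /f Ji ex leqNgt ltnS leq_addr.
  move/leq_trans; apply; under eq_bigr do rewrite -addn1.
  by rewrite big_split /= sum1_card leq_add2l (leq_trans (max_card _)) ?card_ord.
have lowJ x (i : 'I_n) : x \in S -> i \notin J -> ext x i <= n.
  move=> Sx nJi; have : M < M - ext x i + n.
    apply: leq_trans ltM _; rewrite leq_add2r -(sum_ext x).
    rewrite [X in _ <= X - _](bigD1 i) //= addKn.
    rewrite big_mkcond [X in _ <= X]big_mkcond /=; apply: leq_sum => j _.
    have [->|] := eqVneq j i; first by rewrite (negbTE nJi).
    by case: ifP => // _ _; have [_] := Hmu j; apply.
  have : ext x i <= M by rewrite -(sum_ext x) (bigD1 i) //= leq_addr.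
  by lia.
have uppJ x (i : 'I_n) : x \in S -> i \in J -> ext x i <= mu i + n.
  move=> Sx Ji; move: ltM; rewrite (bigD1 i) //=.
  have : ext x i + \sum_(j in J | j != i) mu j <= M.
    rewrite -(sum_ext x) [X in _ <= X](bigD1 i) //= leq_add2l.
    rewrite big_mkcond [X in _ <= X]big_mkcond /=; apply: leq_sum => j _.
    have [_|_] := eqVneq j i; rewrite ?andbF ?andbT //=.
    by case: ifP => // _; have [_] := Hmu j; apply.
  by move: (\sum_(j in J | j != i) mu j) (mu i) (ext x i) => a b d; lia.
have spread x x' (i : 'I_n) : x \in S -> x' \in S -> ext x i <= ext x' i + n.
  move=> Sx Sx'; have [Ji|nJi] := boolP (i \in J).
    by apply: leq_trans (uppJ _ _ Sx Ji) _; rewrite leq_add2r; have [_] := Hmu i; apply.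
  by apply: leq_trans (lowJ _ _ Sx nJi) (leq_addl _ _).
(* For [i] in [J] take a member of [S] with colour [i]; off [J] any member will do, because
   coordinate [i] is small there. *)
have [y Hy] : exists y : 'I_n -> X, forall i, y i \in S /\ (i \in J -> c (y i) = i).
  apply: (@fin_all_exists _ (fun=> X) (fun i x => x \in S /\ (i \in J -> c x = i))) => i.
  have [/imsetP[x Sx ->]|nJi] := boolP (i \in J); first by exists x.
  by exists x0.
exists (ext x0), (fun k => if insub k is Some i then ext (y i) else ext x0).
split=> // k lt_kn; rewrite insubT; set i := Sub k _.
have [Sy cy] := Hy i; split=> //.
  by move=> l lt_ln; split; apply: (spread _ _ (Ordinal lt_ln)).
have [Ji|nJi] := boolP (i \in J); first by right; have := cP (y i); rewrite cy.
by left; apply: (lowJ _ i).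
Qed.

End Scarf.

(** * Complementarity on the simplex *)

Definition in_simplex (N : nat) (x : nat -> R) : Prop :=
  (forall i, (i < N)%nat -> 0 <= x i) /\ msum N x = 1.

Module Simplex_grid.
From mathcomp Require Import all_boot.

Lemma INR_addn (a b : nat) : INR (a + b)%N = INR a + INR b.
Proof. exact: plus_INR. Qed.

Lemma msum_INR (n : nat) (x : nat -> nat) (d : R) :
  msum n (fun i => INR (x i) / d) = INR (\sum_(i < n) x i) / d.
Proof.
elim: n => [|n IH] /=; first by rewrite big_ord0 /Rdiv Rmult_0_l.
by rewrite big_ord_recr /= IH INR_addn /Rdiv Rmult_plus_distr_r.
Qed.

(** Grid points divided by M lie in the simplex, and the integer error N becomes N/M. *)
Lemma simplex_approx (N M : nat) (P : nat -> (nat -> R) -> Prop) :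
  lt 1 N -> lt 0 M ->
  (forall x, in_simplex N x -> exists i, lt i N /\ P i x) ->
  exists (x : nat -> R) (y : nat -> nat -> R),
    in_simplex N x /\
    forall i, lt i N -> in_simplex N (y i) /\
      (forall j, lt j N -> Rabs (y i j - x j) <= INR N / INR M) /\
      (x i <= INR N / INR M \/ P i (y i)).
Proof.
move=> /ltP N1 /lt_0_INR M0 HP.
have iM0 : 0 < / INR M by apply: Rinv_0_lt_compat.
have scale_simplex (x : nat -> nat) :
    (\sum_(i < N) x i = M)%N -> in_simplex N (fun i => INR (x i) / INR M).
  move=> sx; split; last by rewrite msum_INR sx; field; lra.
  by move=> i _; apply: Rmult_le_pos; [exact: pos_INR|lra].
have [] := @Scarf.simplex_grid N M (fun i x => P i (fun j => INR (x j) / INR M)) N1.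
  move=> x /scale_simplex /HP [i [/ltP iN Pi]]; by exists i.
move=> x [y [sx Hy]].
exists (fun i => INR (x i) / INR M), (fun i j => INR (y i j) / INR M).
split; first exact: scale_simplex.
move=> i /ltP iN; have [syi Hyi Pi] := Hy i iN.
split; first exact: scale_simplex.
split.
  move=> j /ltP jN; have [/leP/le_INR h1 /leP/le_INR h2] := Hyi j jN.
  rewrite !INR_addn in h1 h2.
  have -> : INR (y i j) / INR M - INR (x j) / INR M = (INR (y i j) - INR (x j)) / INR M.
    by field; lra.
  apply: Rabs_le; split; first by rewrite /Rdiv; nra.
  by rewrite /Rdiv; nra.
case: Pi => [/leP/le_INR h|Pi]; last by right.
by left; rewrite /Rdiv; nra.
Qed.

End Simplex_grid.


(** Coordinates are treated one at a time, each by a further extraction. Extractions are only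
    required to tend to infinity, a property stable under composition and sufficient for limits. *)
Lemma bolzano_weierstrass_vec (N : nat) (u : nat -> nat -> R) :
  (forall m i, (i < N)%nat -> 0 <= u m i <= 1) ->
  exists (phi : nat -> nat) (l : nat -> R),
    filterlim phi eventually eventually /\
    forall i, (i < N)%nat -> is_lim_seq (fun m => u (phi m) i) (l i).
Proof.
  induction N as [|N IH]; intros Hu.
  - exists (fun m => m), (fun _ => 0). split; [apply filterlim_id | intros; lia].
  - destruct IH as (phi & l & Hphi & Hl). { intros; apply Hu; lia. }
    destruct (Bolzano_Weierstrass (fun m => u (phi m) N) (fun x => 0 <= x <= 1)
                (compact_P3 0 1)) as [lN HlN].
    { intros m; apply Hu; lia. }
    assert (Hc : forall m, exists p,
              (m <= p)%nat /\ Rabs (u (phi p) N - lN) < / (INR m + 1)).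
    { intros m.
      assert (Hm : 0 < / (INR m + 1)).
      { apply Rinv_0_lt_compat; pose proof (pos_INR m); lra. }
      destruct (HlN (disc lN (mkposreal _ Hm)) m) as (p & Hp & Hd).
      { exists (mkposreal _ Hm); intros x Hx; exact Hx. }
      exists p; split; [exact Hp | exact Hd]. }
    apply functional_choice in Hc. destruct Hc as [psi Hpsi].
    assert (Hpsi' : filterlim psi eventually eventually).
    { intros P [n Hn]; exists n; intros m Hm; apply Hn.
      destruct (Hpsi m); lia. }
    exists (fun m => phi (psi m)), (fun i => if Nat.eqb i N then lN else l i).
    split; [eapply filterlim_comp; eassumption|].
    intros i Hi. destruct (Nat.eqb_spec i N) as [->|Hne].
    + apply is_lim_seq_spec; intros eps.
      destruct (archimed_cor1 eps (cond_pos eps)) as (n & Hn & Hn0).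
      exists n; intros m Hm. destruct (Hpsi m) as [_ Hd].
      eapply Rlt_trans; [exact Hd|]. eapply Rle_lt_trans; [|exact Hn].
      apply Rinv_le_contravar; [apply lt_0_INR; lia|].
      apply le_INR in Hm; lra.
    + apply (is_lim_seq_subseq (fun m => u (phi m) i)); [exact Hpsi'|].
      apply Hl; lia.
Qed.

(** * Finite real sums *)

Lemma msum_ext (n : nat) (f g : nat -> R) :
  (forall i, (i < n)%nat -> f i = g i) -> msum n f = msum n g.
Proof.
  induction n as [|n IH]; intros H; simpl; [easy|].
  rewrite IH by (intros; apply H; lia). rewrite H by lia. easy.
Qed.

Lemma msum_le (n : nat) (f g : nat -> R) :
  (forall i, (i < n)%nat -> f i <= g i) -> msum n f <= msum n g.
Proof.
  induction n as [|n IH]; intros H; simpl; [lra|].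
  apply Rplus_le_compat; [apply IH; intros|]; apply H; lia.
Qed.

Lemma msum_scal (n : nat) (c : R) (f : nat -> R) :
  msum n (fun i => c * f i) = c * msum n f.
Proof. induction n as [|n IH]; simpl; [ring | rewrite IH; ring]. Qed.

Lemma msum_plus (n : nat) (f g : nat -> R) :
  msum n (fun i => f i + g i) = msum n f + msum n g.
Proof. induction n as [|n IH]; simpl; [ring | rewrite IH; ring]. Qed.

Lemma msum_const (n : nat) (c : R) : msum n (fun _ => c) = INR n * c.
Proof. induction n as [|n IH]; [simpl; ring | rewrite S_INR; simpl; rewrite IH; ring]. Qed.

Lemma msum_ge_term (n : nat) (f : nat -> R) (k : nat) :
  (forall i, (i < n)%nat -> 0 <= f i) -> (k < n)%nat -> f k <= msum n f.
Proof.
  induction n as [|n IH]; intros H Hk; [lia|]; simpl.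
  assert (H0 : 0 <= msum n f).
  { rewrite <- (Rmult_0_r (INR n)), <- msum_const. apply msum_le; intros; apply H; lia. }
  destruct (Nat.eq_dec k n) as [->|]; [lra|].
  assert (f k <= msum n f) by (apply IH; [intros; apply H|]; lia).
  specialize (H n ltac:(lia)); lra.
Qed.

Lemma msum_lt (n : nat) (f g : nat -> R) (k : nat) :
  (forall i, (i < n)%nat -> f i <= g i) -> (k < n)%nat -> f k < g k ->
  msum n f < msum n g.
Proof.
  intros Hle Hk Hlt.
  assert (H : g k + -1 * f k <= msum n (fun i => g i + -1 * f i)).
  { apply (msum_ge_term n (fun i => g i + -1 * f i)); [|exact Hk].
    intros i Hi; specialize (Hle i Hi); lra. }
  rewrite msum_plus, msum_scal in H; lra.
Qed.

Lemma is_lim_seq_msum (n : nat) (f : nat -> nat -> R) (l : nat -> R) :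
  (forall i, (i < n)%nat -> is_lim_seq (fun m => f m i) (l i)) ->
  is_lim_seq (fun m => msum n (f m)) (msum n l).
Proof.
  induction n as [|n IH]; intros H; simpl.
  - apply is_lim_seq_const.
  - apply is_lim_seq_plus'; [apply IH; intros|]; apply H; lia.
Qed.

Lemma in_simplex_le_1 (N : nat) (x : nat -> R) (i : nat) :
  in_simplex N x -> (i < N)%nat -> x i <= 1.
Proof. intros [H0 H1] Hi; rewrite <- H1; apply msum_ge_term; assumption. Qed.

(** Approximate solutions on grids of vanishing mesh have a convergent subsequence, and the nearby
    points where the inequalities hold converge to the same limit [l]. The third hypothesis is
    sequential continuity, which carries the inequalities to [l]. *)
Lemma simplex_complementarity (N : nat) (g : nat -> (nat -> R) -> R) :
  (0 < N)%nat ->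
  (forall x, in_simplex N x -> exists i, (i < N)%nat /\ 0 <= g i x) ->
  (forall (u : nat -> nat -> R) (l : nat -> R) i, (i < N)%nat ->
     (forall m, in_simplex N (u m)) -> in_simplex N l ->
     (forall j, (j < N)%nat -> is_lim_seq (fun m => u m j) (l j)) ->
     is_lim_seq (fun m => g i (u m)) (g i l)) ->
  exists x, in_simplex N x /\
    forall i, (i < N)%nat -> x i = 0 \/ 0 <= g i x.
Proof.
  intros HN Hcov Hcont.
  (* Scarf's lemma requires two orders; for N = 1 the simplex is a single point. *)
  destruct (Nat.eq_dec N 1) as [->|HN1].
  { exists (fun _ => 1).
    assert (Hs : in_simplex 1 (fun _ => 1)) by (split; [intros; lra | simpl; lra]).
    split; [exact Hs|]. intros i Hi.
    destruct (Hcov _ Hs) as (k & Hk & Hg).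
    right. replace i with k by lia. exact Hg. }
  assert (Hap : forall m, exists p : (nat -> R) * (nat -> nat -> R),
    in_simplex N (fst p) /\
    forall i, (i < N)%nat -> in_simplex N (snd p i) /\
      (forall j, (j < N)%nat -> Rabs (snd p i j - fst p j) <= INR N / INR (S m)) /\
      (fst p i <= INR N / INR (S m) \/ 0 <= g i (snd p i))).
  { intros m.
    destruct (Simplex_grid.simplex_approx N (S m) (fun i x => 0 <= g i x)) as (x & y & H);
      [lia | lia | exact Hcov |]. exists (x, y); exact H. }
  apply functional_choice in Hap. destruct Hap as [p Hp].
  destruct (bolzano_weierstrass_vec N (fun m => fst (p m))) as (phi & l & Hphi & Hl).
  { intros m i Hi. destruct (Hp m) as [Hs _]. split; [apply Hs; exact Hi|].
    apply (in_simplex_le_1 N); assumption. }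
  assert (Herr : is_lim_seq (fun m => INR N / INR (S (phi m))) 0).
  { apply (is_lim_seq_subseq (fun m => INR N / INR (S m))); [exact Hphi|].
    apply (is_lim_seq_incr_1 (fun m => INR N / INR m)).
    replace 0 with (INR N * 0) by ring. apply is_lim_seq_mult'; [apply is_lim_seq_const|].
    replace (Finite 0) with (Rbar_inv p_infty) by reflexivity.
    apply is_lim_seq_inv; [apply is_lim_seq_INR | discriminate]. }
  assert (Hls : in_simplex N l).
  { split.
    - intros i Hi.
      apply (is_lim_seq_le (fun _ => 0) (fun m => fst (p (phi m)) i) 0 (l i));
        [|apply is_lim_seq_const | apply Hl; exact Hi].
      intros m; apply (Hp (phi m)); exact Hi.
    - assert (H1 := is_lim_seq_msum N _ _ Hl).
      apply (is_lim_seq_ext _ (fun _ => 1)) in H1;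
        [|intros m; apply (Hp (phi m))].
      assert (H2 := is_lim_seq_const 1).
      apply is_lim_seq_unique in H1; apply is_lim_seq_unique in H2.
      rewrite H1 in H2; injection H2; auto. }
  exists l; split; [exact Hls|]. intros i Hi.
  destruct (proj1 Hls i Hi) as [Hpos|H0]; [right|left; lra].
  assert (Hyl : forall j, (j < N)%nat -> is_lim_seq (fun m => snd (p (phi m)) i j) (l j)).
  { intros j Hj.
    apply (is_lim_seq_le_le
             (fun m => fst (p (phi m)) j - INR N / INR (S (phi m))) _
             (fun m => fst (p (phi m)) j + INR N / INR (S (phi m)))).
    - intros m. destruct (Hp (phi m)) as [_ H]. destruct (H i Hi) as (_ & H' & _).
      specialize (H' j Hj). apply Rabs_le_between in H'. lra.
    - replace (l j) with (l j - 0) by ring. apply is_lim_seq_minus'; auto.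
    - replace (l j) with (l j + 0) by ring. apply is_lim_seq_plus'; auto. }
  assert (Hg := Hcont (fun m => snd (p (phi m)) i) l i Hi
                  (fun m => proj1 (proj2 (Hp (phi m)) i Hi)) Hls Hyl).
  refine (is_lim_seq_le_loc (fun _ => 0) _ 0 (g i l) _ (is_lim_seq_const 0) Hg).
  (* As [l i] is positive, the alternative of a small [i]-th coordinate is eventually excluded. *)
  assert (Hev : eventually (fun m => INR N / INR (S (phi m)) < fst (p (phi m)) i)).
  { assert (Hd := is_lim_seq_minus' _ _ _ _ (Hl i Hi) Herr).
    apply is_lim_seq_spec in Hd.
    destruct (Hd (mkposreal (l i) Hpos)) as [n Hn]. exists n; intros m Hm.
    assert (Hd' : Rabs (fst (p (phi m)) i - INR N / INR (S (phi m)) - (l i - 0)) < l i)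
      by exact (Hn m Hm).
    apply Rabs_lt_between in Hd'. lra. }
  revert Hev. apply filter_imp. intros m Hm.
  destruct (proj2 (Hp (phi m)) i Hi) as (_ & _ & [H|H]); [lra | exact H].
Qed.

(** * Trust vectors *)

Lemma Rpower_pos (x y : R) : 0 < Rpower x y.
Proof. apply exp_pos. Qed.

Lemma Rpower_root (x y : R) : 0 < x -> y <> 0 -> Rpower (Rpower x (/ y)) y = x.
Proof.
  intros Hx Hy. rewrite Rpower_mult, Rinv_l by exact Hy. apply Rpower_1; exact Hx.
Qed.

Lemma Rpower_lt_l (x y z : R) : 0 < z -> 0 < x -> x < y -> Rpower x z < Rpower y z.
Proof.
  intros Hz Hx Hxy. unfold Rpower. apply exp_increasing, Rmult_lt_compat_l; [exact Hz|].
  apply ln_increasing; assumption.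
Qed.

Lemma is_lim_seq_Rpower (u : nat -> R) (l y : R) :
  0 < l -> is_lim_seq u l -> is_lim_seq (fun m => Rpower (u m) y) (Rpower l y).
Proof.
  intros Hl Hu. apply (is_lim_seq_continuous (fun x => Rpower x y)); [|exact Hu].
  apply derivable_continuous_pt. eexists. apply derivable_pt_lim_power. exact Hl.
Qed.

Lemma argmax_below (N : nat) (f : nat -> R) :
  (0 < N)%nat -> exists k, (k < N)%nat /\ forall j, (j < N)%nat -> f j <= f k.
Proof.
  induction N as [|[|N] IH]; intros HN; [lia| |].
  - exists 0%nat; split; [lia|]. intros j Hj. replace j with 0%nat by lia. lra.
  - destruct IH as (k & Hk & Hmax); [lia|].
    destruct (Rle_dec (f k) (f (S N))) as [H|H].
    + exists (S N); split; [lia|]. intros j Hj.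
      destruct (Nat.eq_dec j (S N)) as [->|]; [lra|]. specialize (Hmax j ltac:(lia)); lra.
    + exists k; split; [lia|]. intros j Hj.
      destruct (Nat.eq_dec j (S N)) as [->|]; [lra|]. apply Hmax; lia.
Qed.

Lemma nonneg_mx_bounded (N : nat) (h : nat -> nat -> R) :
  nonneg_mx N h ->
  exists K, 0 < K /\ forall i j, (i < N)%nat -> (j < N)%nat -> h i j <= K.
Proof.
  intros Hh.
  assert (Hrow : forall i, (i < N)%nat -> 0 <= msum N (h i)).
  { intros i Hi. rewrite <- (Rmult_0_r (INR N)), <- msum_const.
    apply msum_le; intros; apply Hh; assumption. }
  (* The sum of all entries bounds each of them; adding 1 makes the bound positive even for a zero
     matrix. *)
  exists (1 + msum N (fun i => msum N (h i))). split.
  - assert (0 <= msum N (fun i => msum N (h i))); [|lra].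
    rewrite <- (Rmult_0_r (INR N)), <- msum_const. apply msum_le; exact Hrow.
  - intros i j Hi Hj.
    assert (h i j <= msum N (h i)) by (apply msum_ge_term; auto).
    assert (msum N (h i) <= msum N (fun i => msum N (h i)))
      by (apply (msum_ge_term N (fun i => msum N (h i))); auto).
    lra.
Qed.

(** The lower bound is the inverse of an upper bound for the entrywise inverses; the convention
    [/ 0 = 0] keeps these nonnegative. *)
Lemma positive_entries_bounds (N : nat) (T : nat -> nat -> R) :
  nonneg_mx N T ->
  exists a b, 0 < a /\ 0 < b /\
    forall i j, (i < N)%nat -> (j < N)%nat -> 0 < T i j -> a <= T i j <= b.
Proof.
  intros HT.
  destruct (nonneg_mx_bounded N T HT) as (b & Hb & Hle).
  destruct (nonneg_mx_bounded N (fun i j => / T i j)) as (K & HK & HleK).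
  { intros i j Hi Hj. destruct (HT i j Hi Hj) as [H|<-].
    - left; apply Rinv_0_lt_compat; exact H.
    - rewrite Rinv_0; lra. }
  exists (/ K), b. split; [apply Rinv_0_lt_compat; exact HK|]. split; [exact Hb|].
  intros i j Hi Hj Hpos. split; [|apply Hle; assumption].
  rewrite <- (Rinv_inv (T i j)). apply Rinv_le_contravar; [|apply HleK; assumption].
  apply Rinv_0_lt_compat; exact Hpos.
Qed.

(** A positive diagonal entry of a power of [T] needs a nonzero last factor [T l i]. *)
Lemma irreducible_column (N : nat) (T : nat -> nat -> R) (i : nat) :
  nonneg_mx N T -> irreducible N T -> (i < N)%nat ->
  exists l, (l < N)%nat /\ 0 < T l i.
Proof.
  intros HT Hirr Hi. apply Classical_Prop.NNPP; intros Hno.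
  destruct (Hirr i i Hi Hi) as ([|k] & Hk & Hpow); [lia|].
  revert Hpow. simpl. unfold mulmx. rewrite (msum_ext N _ (fun _ => 0)).
  - rewrite msum_const; lra.
  - intros l Hl. replace (T l i) with 0; [ring|].
    destruct (HT l i Hl Hi) as [H|H]; [|exact H].
    exfalso; apply Hno; exists l; auto.
Qed.

Lemma mulmv_scal (N : nat) (M : nat -> nat -> R) (c : R) (v : nat -> R) (i : nat) :
  mulmv N M (fun j => c * v j) i = c * mulmv N M v i.
Proof.
  unfold mulmv. rewrite <- msum_scal. apply msum_ext; intros; ring.
Qed.

Lemma is_lim_seq_mulmv (N : nat) (M : nat -> nat -> R) (v : nat -> nat -> R)
    (l : nat -> R) (i : nat) :
  (forall j, (j < N)%nat -> is_lim_seq (fun m => v m j) (l j)) ->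
  is_lim_seq (fun m => mulmv N M (v m) i) (mulmv N M l i).
Proof.
  intros H. apply (is_lim_seq_msum N (fun m j => M i j * v m j)).
  intros j Hj. apply is_lim_seq_mult'; [apply is_lim_seq_const | auto].
Qed.

(** * The two means over S_i and the map built from them *)

Section Trust.
Variables (N : nat) (T : nat -> nat -> R) (alpha a b : R).
Hypothesis T_nonneg : nonneg_mx N T.
Hypothesis T_column : forall i, (i < N)%nat -> exists l, (l < N)%nat /\ 0 < T l i.
Hypothesis alpha_pos : 0 < alpha.
Hypothesis a_pos : 0 < a.
Hypothesis b_pos : 0 < b.
Hypothesis T_bounds :
  forall i j, (i < N)%nat -> (j < N)%nat -> 0 < T i j -> a <= T i j <= b.

Definition trust_rhs (t : nat -> R) (i : nat) : R :=
  Dentry N T alpha t i * mulmv N (trmx T) t i.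

(** The mean v_i: the numerator may run over all j because [T j i] vanishes off S_i. *)
Definition trust_mean (t : nat -> R) (i : nat) : R :=
  mulmv N (trmx T) t i / mulmv N (Cmx T) t i.

(** The mean w_i of [t], weighted by [t] itself. *)
Definition weight_mean (t : nat -> R) (i : nat) : R :=
  mulmv N (Cmx T) (fun j => t j * t j) i / mulmv N (Cmx T) t i.

Let positive (t : nat -> R) : Prop := forall j, (j < N)%nat -> 0 < t j.

(** The column condition makes S_i nonempty, so both means have positive denominators. *)
Lemma Cmx_mulmv_pos (t : nat -> R) (i : nat) :
  positive t -> (i < N)%nat -> 0 < mulmv N (Cmx T) t i.
Proof.
  intros Ht Hi. destruct (T_column i Hi) as (l & Hl & Hpos).
  apply Rlt_le_trans with (Cmx T i l * t l).
  - unfold Cmx. destruct (Rlt_dec 0 (T l i)); [|lra]. rewrite Rmult_1_l; auto.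
  - apply (msum_ge_term N (fun j => Cmx T i j * t j)); [|exact Hl].
    intros j Hj. specialize (Ht j Hj). unfold Cmx. destruct Rlt_dec; lra.
Qed.

Lemma trust_mean_bounds (t : nat -> R) (i : nat) :
  positive t -> (i < N)%nat -> a <= trust_mean t i <= b.
Proof.
  intros Ht Hi. assert (HS := Cmx_mulmv_pos t i Ht Hi). unfold trust_mean.
  assert (Hterm : forall j, (j < N)%nat ->
            a * (Cmx T i j * t j) <= trmx T i j * t j <= b * (Cmx T i j * t j)).
  { intros j Hj. specialize (Ht j Hj). unfold Cmx, trmx.
    destruct (Rlt_dec 0 (T j i)) as [H|H].
    - specialize (T_bounds j i Hj Hi H). nra.
    - specialize (T_nonneg j i Hj Hi). assert (T j i = 0) as -> by lra. lra. }
  split; [apply Rle_div_r | apply Rle_div_l]; try exact HS;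
    unfold mulmv; rewrite <- msum_scal; apply msum_le; intros j Hj; apply Hterm; exact Hj.
Qed.

Lemma weight_mean_bounds (t : nat -> R) (m M : R) (i : nat) :
  positive t -> (forall j, (j < N)%nat -> m <= t j <= M) -> (i < N)%nat ->
  m <= weight_mean t i <= M.
Proof.
  intros Ht Hm Hi. assert (HS := Cmx_mulmv_pos t i Ht Hi). unfold weight_mean.
  split; [apply Rle_div_r | apply Rle_div_l]; try exact HS;
    unfold mulmv; rewrite <- msum_scal; apply msum_le; intros j Hj;
    specialize (Ht j Hj); specialize (Hm j Hj); unfold Cmx; destruct Rlt_dec; nra.
Qed.

Lemma weight_mean_pos (t : nat -> R) (i : nat) :
  positive t -> (i < N)%nat -> 0 < weight_mean t i.
Proof.
  intros Ht Hi. apply Rdiv_lt_0_compat; apply Cmx_mulmv_pos; try assumption.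
  intros j Hj. specialize (Ht j Hj); nra.
Qed.

(** With s_i the sum of [t] over S_i, the sum of squares is w_i s_i; the factor s_i^alpha cancels
    against the denominator s_i^(1+alpha), leaving the s_i of v_i. *)
Lemma trust_rhs_means (t : nat -> R) (i : nat) :
  positive t -> (i < N)%nat ->
  trust_rhs t i = Rpower (weight_mean t i) alpha * trust_mean t i.
Proof.
  intros Ht Hi. assert (HS := Cmx_mulmv_pos t i Ht Hi).
  assert (HW := weight_mean_pos t i Ht Hi).
  unfold trust_rhs, Dentry, trust_mean.
  replace (mulmv N (Cmx T) (fun j => t j * t j) i)
    with (weight_mean t i * mulmv N (Cmx T) t i) by (unfold weight_mean; field; lra).
  rewrite <- Rpower_mult_distr by assumption.
  rewrite Rpower_plus, Rpower_1 by exact HS.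
  assert (HP := Rpower_pos (mulmv N (Cmx T) t i) alpha).
  field; lra.
Qed.

Lemma trust_rhs_bounds (t : nat -> R) (m M : R) (i : nat) :
  0 < m -> (forall j, (j < N)%nat -> m <= t j <= M) -> (i < N)%nat ->
  a * Rpower m alpha <= trust_rhs t i <= b * Rpower M alpha.
Proof.
  intros Hm Hb Hi.
  assert (Ht : positive t) by (intros j Hj; specialize (Hb j Hj); lra).
  rewrite trust_rhs_means by assumption.
  destruct (weight_mean_bounds t m M i Ht Hb Hi) as [W1 W2].
  destruct (trust_mean_bounds t i Ht Hi) as [A1 A2].
  assert (P1 : Rpower m alpha <= Rpower (weight_mean t i) alpha)
    by (apply Rle_Rpower_l; lra).
  assert (P2 : Rpower (weight_mean t i) alpha <= Rpower M alpha)
    by (apply Rle_Rpower_l; lra).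
  assert (P0 := Rpower_pos m alpha). split.
  - rewrite Rmult_comm. apply Rmult_le_compat; lra.
  - rewrite (Rmult_comm b). apply Rmult_le_compat; lra.
Qed.

Lemma trust_rhs_pos (t : nat -> R) (i : nat) :
  positive t -> (i < N)%nat -> 0 < trust_rhs t i.
Proof.
  intros Ht Hi. rewrite trust_rhs_means by assumption.
  apply Rmult_lt_0_compat; [apply Rpower_pos|].
  destruct (trust_mean_bounds t i Ht Hi); lra.
Qed.

(** Under scaling by [c], w_i is multiplied by [c] while v_i is unchanged. *)
Lemma trust_rhs_scal (t : nat -> R) (c : R) (i : nat) :
  0 < c -> positive t -> (i < N)%nat ->
  trust_rhs (fun j => c * t j) i = Rpower c alpha * trust_rhs t i.
Proof.
  intros Hc Ht Hi. assert (HS := Cmx_mulmv_pos t i Ht Hi).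
  rewrite !trust_rhs_means; try assumption.
  2: { intros j Hj; apply Rmult_lt_0_compat; auto. }
  replace (weight_mean (fun j => c * t j) i) with (c * weight_mean t i).
  2: { unfold weight_mean.
       rewrite mulmv_scal.
       replace (mulmv N (Cmx T) (fun j => c * t j * (c * t j)) i)
         with (c * (c * mulmv N (Cmx T) (fun j => t j * t j) i)).
       - field; lra.
       - rewrite <- !mulmv_scal. apply msum_ext; intros; ring. }
  replace (trust_mean (fun j => c * t j) i) with (trust_mean t i).
  2: { unfold trust_mean. rewrite !mulmv_scal. field; lra. }
  rewrite <- Rpower_mult_distr by (try apply weight_mean_pos; assumption). ring.
Qed.

Lemma is_lim_seq_trust_rhs (u : nat -> nat -> R) (t : nat -> R) (i : nat) :
  (forall m, positive (u m)) -> positive t -> (i < N)%nat ->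
  (forall j, (j < N)%nat -> is_lim_seq (fun m => u m j) (t j)) ->
  is_lim_seq (fun m => trust_rhs (u m) i) (trust_rhs t i).
Proof.
  intros Hu Ht Hi Hlim. assert (HS := Cmx_mulmv_pos t i Ht Hi).
  rewrite trust_rhs_means by assumption.
  apply (is_lim_seq_ext (fun m => Rpower (weight_mean (u m) i) alpha * trust_mean (u m) i)).
  { intros m; symmetry; apply trust_rhs_means; auto. }
  apply is_lim_seq_mult'.
  - apply is_lim_seq_Rpower; [apply weight_mean_pos; assumption|].
    apply is_lim_seq_div'; [| |lra].
    + apply (is_lim_seq_mulmv N (Cmx T) (fun m j => u m j * u m j)).
      intros j Hj; apply is_lim_seq_mult'; auto.
    + apply is_lim_seq_mulmv; exact Hlim.
  - apply is_lim_seq_div'; [| |lra]; apply is_lim_seq_mulmv; exact Hlim.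
Qed.

(** The map F whose positive eigenvector is sought. *)
Definition trust_root (t : nat -> R) (i : nat) : R :=
  Rpower (trust_rhs t i) (/ (1 + alpha)).

Lemma trust_root_spec (t : nat -> R) (i : nat) :
  positive t -> (i < N)%nat -> Rpower (trust_root t i) (1 + alpha) = trust_rhs t i.
Proof.
  intros Ht Hi. apply Rpower_root; [apply trust_rhs_pos; assumption | lra].
Qed.

Lemma trust_root_eigenvector_scal (t : nat -> R) (lambda : R) :
  positive t -> 0 < lambda ->
  (forall i, (i < N)%nat -> trust_root t i = lambda * t i) ->
  exists t', positive t' /\
    forall i, (i < N)%nat -> Rpower (t' i) (1 + alpha) = trust_rhs t' i.
Proof.
  (* For [c t] to solve the equation, homogeneity demands c^(1+alpha) = c^alpha lambda^(1+alpha). *)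
  intros Ht Hl Heig. set (c := Rpower lambda (1 + alpha)).
  assert (Hc : 0 < c) by apply Rpower_pos.
  exists (fun j => c * t j). split.
  { intros j Hj; apply Rmult_lt_0_compat; auto. }
  intros i Hi. rewrite trust_rhs_scal by assumption.
  rewrite <- trust_root_spec, Heig by assumption.
  rewrite <- !Rpower_mult_distr by auto. fold c.
  rewrite (Rpower_plus 1 alpha c), Rpower_1 by exact Hc. ring.
Qed.

Lemma trust_eigenvector_exists :
  (0 < N)%nat ->
  exists t lambda, positive t /\ 0 < lambda /\
    forall i, (i < N)%nat -> trust_root t i = lambda * t i.
Proof.
  intros HN. assert (HN' : 0 < INR N) by (apply lt_0_INR; exact HN).
  (* On the simplex shifted by eps, a coordinate with [trust_root t i < lambda * t i]
     must equal eps, while the largest coordinate exceeds 1/N; the bounds on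
     [trust_rhs] force their ratio below b/a, which this eps excludes. *)
  set (eps := a / (INR N * b)).
  assert (Heps : 0 < eps) by (apply Rdiv_lt_0_compat; nra).
  set (s := 1 + INR N * eps).
  assert (Hs : 0 < s) by (unfold s; nra).
  set (shift := fun (x : nat -> R) j => x j + eps).
  (* With lambda the ratio of the sums of F(t) and of t, [g i x] is s (F_i(t) - lambda t_i) at the
     shifted point t. *)
  set (g := fun i x =>
    trust_root (shift x) i * s - shift x i * msum N (trust_root (shift x))).
  assert (Hshift : forall x, in_simplex N x -> positive (shift x)).
  { intros x [Hx _] j Hj. specialize (Hx j Hj). unfold shift; lra. }
  assert (Hsum : forall x, in_simplex N x -> msum N (shift x) = s).
  { intros x [_ Hx]. unfold shift. rewrite msum_plus, msum_const, Hx. reflexivity. }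
  destruct (simplex_complementarity N g HN) as (x & Hx & Hcompl).
  (* The [g i x] sum to zero over i, so they cannot all be negative. *)
  - intros x Hx. apply Classical_Prop.NNPP; intros Hno.
    assert (Hneg : forall i, (i < N)%nat -> g i x < 0).
    { intros i Hi. apply Rnot_le_lt; intros H. apply Hno; exists i; auto. }
    assert (H : msum N (fun i => g i x) < msum N (fun _ => 0)).
    { apply (msum_lt N _ _ 0%nat); [|exact HN|apply Hneg; exact HN].
      intros i Hi; left; apply Hneg; exact Hi. }
    rewrite msum_const in H.
    rewrite (msum_ext N _ (fun i => s * trust_root (shift x) i
        + - msum N (trust_root (shift x)) * shift x i)) in H
      by (intros; unfold g; ring).
    rewrite msum_plus, !msum_scal, (Hsum x Hx) in H.
    change (fun i => trust_root (shift x) i) with (trust_root (shift x)) in H. lra.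
  - intros u l i Hi Hu Hl Hlim.
    assert (Hlim' : forall j, (j < N)%nat ->
              is_lim_seq (fun m => shift (u m) j) (shift l j)).
    { intros j Hj. apply is_lim_seq_plus'; [auto | apply is_lim_seq_const]. }
    assert (Hroot : forall j, (j < N)%nat ->
              is_lim_seq (fun m => trust_root (shift (u m)) j) (trust_root (shift l) j)).
    { intros j Hj. apply is_lim_seq_Rpower; [apply trust_rhs_pos; auto|].
      apply is_lim_seq_trust_rhs; auto. }
    apply is_lim_seq_minus'; apply is_lim_seq_mult'; auto.
    + apply is_lim_seq_const.
    + apply is_lim_seq_msum; exact Hroot.
  - set (t := shift x) in *. assert (Ht : positive t) by (apply Hshift; exact Hx).
    set (lambda := msum N (trust_root t) / s).
    assert (Hl : 0 < lambda).
    { apply Rdiv_lt_0_compat; [|exact Hs].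
      apply Rlt_le_trans with (trust_root t 0%nat); [apply Rpower_pos|].
      apply msum_ge_term; [|exact HN]. intros; left; apply Rpower_pos. }
    assert (Hg : forall i, g i x = s * (trust_root t i - lambda * t i))
      by (intros i; unfold g, lambda; fold t; field; lra).
    assert (Hge : forall i, (i < N)%nat -> lambda * t i <= trust_root t i).
    { intros i Hi. destruct (Hcompl i Hi) as [H0|H]; [|rewrite Hg in H; nra].
      apply Rnot_lt_le; intros Hlt.
      assert (Hti : t i = eps) by (unfold t, shift; rewrite H0; ring).
      destruct (argmax_below N x HN) as (k & Hk & Hmax).
      assert (Hxk : 1 <= INR N * x k).
      { rewrite <- msum_const, <- (proj2 Hx). apply msum_le; exact Hmax. }
      assert (Hbd : forall j, (j < N)%nat -> eps <= t j <= t k).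
      { intros j Hj. assert (0 <= x j) by (apply Hx; exact Hj).
        specialize (Hmax j Hj). unfold t, shift; lra. }
      assert (Hgk : lambda * t k <= trust_root t k).
      { destruct (Hcompl k Hk) as [H|H]; [rewrite H in Hxk; lra|]. rewrite Hg in H; nra. }
      set (L := Rpower lambda (1 + alpha)).
      assert (HL : 0 < L) by apply Rpower_pos.
      assert (Htk := Ht k Hk).
      (* Raise lambda t_k <= F_k(t) to the power 1+alpha and divide by t_k^alpha. *)
      assert (Hup : L * t k <= b).
      { apply Rmult_le_reg_r with (Rpower (t k) alpha); [apply Rpower_pos|].
        apply Rle_trans with (trust_rhs t k); [|apply (trust_rhs_bounds t eps); assumption].
        rewrite <- trust_root_spec by assumption.
        replace (L * t k * Rpower (t k) alpha) with (Rpower (lambda * t k) (1 + alpha)).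
        - apply Rle_Rpower_l; [lra|]. split; [apply Rmult_lt_0_compat; assumption | exact Hgk].
        - rewrite <- Rpower_mult_distr, (Rpower_plus 1 alpha (t k)), Rpower_1 by assumption.
          unfold L; ring. }
      (* The same computation at [i], where t_i = eps and the inequality is reversed and strict. *)
      assert (Hlow : a < L * eps).
      { apply Rmult_lt_reg_r with (Rpower eps alpha); [apply Rpower_pos|].
        apply Rle_lt_trans with (trust_rhs t i);
          [apply (trust_rhs_bounds t eps (t k)); assumption|].
        rewrite <- trust_root_spec by assumption.
        replace (L * eps * Rpower eps alpha) with (Rpower (lambda * t i) (1 + alpha)).
        - apply Rpower_lt_l; [lra | apply Rpower_pos | exact Hlt].
        - rewrite Hti, <- Rpower_mult_distr, (Rpower_plus 1 alpha eps), Rpower_1 by assumption.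
          unfold L; ring. }
      assert (Hxt : x k <= t k) by (unfold t, shift; lra).
      (* From t_k >= x_k >= 1/N; hence L eps <= N b eps = a, contradicting the strict lower
         bound. *)
      assert (HLN : L <= INR N * b).
      { apply Rle_trans with (INR N * (L * t k)); [|apply Rmult_le_compat_l; lra].
        apply Rle_trans with (L * (INR N * x k)); [nra|].
        replace (INR N * (L * t k)) with (L * (INR N * t k)) by ring.
        apply Rmult_le_compat_l; [lra|]. apply Rmult_le_compat_l; lra. }
      assert (L * eps <= INR N * b * eps) by (apply Rmult_le_compat_r; lra).
      assert (INR N * b * eps = a) by (unfold eps; field; lra).
      lra. }
    exists t, lambda. split; [exact Ht|]. split; [exact Hl|]. intros i Hi.
    apply Rle_antisym; [|apply Hge; exact Hi].
    apply Rnot_lt_le; intros Hlt.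
    (* Both sides have the same sum by the choice of lambda, so no coordinate inequality can be
       strict. *)
    assert (H := msum_lt N (fun i => lambda * t i) (trust_root t) i Hge Hi Hlt).
    rewrite msum_scal in H. change (fun i => t i) with t in H.
    rewrite (Hsum x Hx : msum N t = s) in H.
    replace (lambda * s) with (msum N (trust_root t)) in H by (unfold lambda; field; lra).
    lra.
Qed.

End Trust.

Theorem theorem3 (N : nat) (T : nat -> nat -> R) (alpha : R) :
  nonneg_mx N T -> irreducible N T -> 0 < alpha ->
  exists t : nat -> R,
    (forall i, (i < N)%nat -> 0 < t i) /\
    (forall i, (i < N)%nat ->
       Rpower (t i) (1 + alpha) =
       Dentry N T alpha t i * mulmv N (trmx T) t i).
Proof.
  intros HT Hirr Halpha.
  destruct (Nat.eq_dec N 0) as [->|HN].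
  { exists (fun _ => 1). split; intros; lia. }
  destruct (positive_entries_bounds N T HT) as (a & b & Ha & Hb & Hab).
  assert (Hcol := fun i => irreducible_column N T i HT Hirr).
  destruct (trust_eigenvector_exists N T alpha a b HT Hcol Halpha Ha Hb Hab)
    as (t & lambda & Ht & Hl & Heig); [lia|].
  exact (trust_root_eigenvector_scal N T alpha a b HT Hcol Halpha Ha Hab
           t lambda Ht Hl Heig).
Qed.
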